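(* Let $A \in \mathbb{R}^{m \times n}$, $b \in \mathbb{R}^m$, $N \in \mathbb{R}^{n \times p}$ and $M \in \mathbb{R}^{m \times q}$. Let $x^*$ be the min-length solution of the least squares problem $\min_{x} \|A x - b\|_2$; let $x^*_{\mathrm{right}} = N y^*$, where $y^*$ is the min-length solution of $\min_{y} \|A N y - b\|_2$; and let $x^*_{\mathrm{left}}$ be the min-length solution of $\min_x \|M^{T} A x - M^{T} b\|_2$. Then: (1) if $\operatorname{range}(N) = \operatorname{range}(A^{T})$, then $x^*_{\mathrm{right}} = x^*$; (2) if $\operatorname{range}(M) = \operatorname{range}(A)$, then $x^*_{\mathrm{left}} = x^*$.
   Context: For a least squares problem $\min_z \|Bz - c\|_2$, the min-length solution is the unique minimizer of $\|z\|_2$ over the (convex, nonempty) set of minimizers of $\|Bz-c\|_2$; it equals $B^\dagger c$, where $B^\dagger$ is the Moore–Penrose pseudoinverse. $\operatorname{range}(B)$ denotes the column space of $B$. *)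

(* Defs.v *)
From HB Require Import structures.
From mathcomp Require Import all_boot all_order all_algebra.
From mathcomp Require Import classical_sets reals.
Set Implicit Arguments.
Unset Strict Implicit.
Unset Printing Implicit Defensive.
Import Order.TTheory GRing.Theory Num.Theory.
Local Open Scope ring_scope.

Section LeastSquares.
Variable R : rcfType.

Definition norm2 (n : nat) (v : 'cV[R]_n) : R :=
  Num.sqrt (\sum_(i < n) v i 0 ^+ 2).

Definition colrange (m n : nat) (B : 'M[R]_(m, n)) : set 'cV[R]_m :=
  range (fun z : 'cV[R]_n => B *m z).

Definition is_lsq_solution (m n : nat) (B : 'M[R]_(m, n)) (c : 'cV[R]_m)
    (z : 'cV[R]_n) : Prop :=
  forall z' : 'cV[R]_n, norm2 (B *m z - c) <= norm2 (B *m z' - c).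

Definition is_min_length_solution (m n : nat) (B : 'M[R]_(m, n))
    (c : 'cV[R]_m) (z : 'cV[R]_n) : Prop :=
  is_lsq_solution B c z /\
  forall z' : 'cV[R]_n, is_lsq_solution B c z' -> norm2 z <= norm2 z'.

Let sqn n (v : 'cV[R]_n) : R := \sum_(i < n) v i 0 ^+ 2.

Let sqnE n (v : 'cV[R]_n) : sqn v = (v^T *m v) 0 0.
Proof. by rewrite mxE; apply: eq_bigr => i _; rewrite mxE expr2. Qed.

Let sqn_ge0 n (v : 'cV[R]_n) : 0 <= sqn v.
Proof. by apply: sumr_ge0 => i _; apply: sqr_ge0. Qed.

Let norm2_le n k (u : 'cV[R]_n) (v : 'cV[R]_k) :
  (norm2 u <= norm2 v) = (sqn u <= sqn v).
Proof. exact/ler_sqrt/sqn_ge0. Qed.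

Let sqn_eq0 n (v : 'cV[R]_n) : sqn v <= 0 -> v = 0.
Proof.
move=> v0; have /eqP : sqn v = 0 by apply/eqP; rewrite eq_le v0 sqn_ge0.
rewrite psumr_eq0 => [/allP h|i _]; last exact: sqr_ge0.
apply/colP => i; rewrite mxE; apply/eqP.
by rewrite -sqrf_eq0; apply: h; rewrite mem_index_enum.
Qed.

Let sqnD n (u v : 'cV[R]_n) : u^T *m v = 0 -> sqn (u + v) = sqn u + sqn v.
Proof.
move=> uv; have vu : v^T *m u = 0.
  by apply: trmx_inj; rewrite trmx_mul trmxK uv trmx0.
have uvT : (u + v)^T = u^T + v^T by exact: raddfD.
by rewrite !sqnE uvT mulmxDl !mulmxDr uv vu addr0 add0r mxE.
Qed.

Let mul_tr_eq0 m n k (B : 'M[R]_(m, n)) (u : 'M[R]_(k, m)) :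
  u *m B *m B^T = 0 -> u *m B = 0.
Proof.
move=> h; apply/row_matrixP => i; rewrite row0; apply: trmx_inj; rewrite trmx0.
apply: sqn_eq0; rewrite sqnE trmxK row_mul trmx_mul !mulmxA -!row_mul h.
by rewrite mul0mx row0 mxE.
Qed.

Let normal_eq m n (B : 'M[R]_(m, n)) (c : 'cV[R]_m) :
  exists w : 'cV[R]_m, B^T *m (B *m (B^T *m w)) = B^T *m c.
Proof.
have le : (B *m B^T *m B <= B)%MS by apply: submxMl.
have sub : (B <= B *m B^T *m B)%MS.
  rewrite -(geq_leqif (mxrank_leqif_sup le)).
  have kk : (kermx (B *m B^T *m B) <= kermx B)%MS.
    rewrite sub_kermx; apply/eqP/mul_tr_eq0/mul_tr_eq0.
    apply: etrans (mulmx_ker (B *m B^T *m B)).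
    by rewrite trmxK !mulmxA.
  by have := mxrankS kk; rewrite !mxrank_ker leq_sub2lE ?rank_leq_row.
have /submxP[D hD] : (c^T *m B <= B *m B^T *m B)%MS.
  exact: submx_trans (submxMl _ _) sub.
exists D^T; apply: trmx_inj.
by rewrite !trmx_mul !trmxK hD !mulmxA.
Qed.

Lemma min_length_solution_exists_unique (m n : nat) (B : 'M[R]_(m, n))
    (c : 'cV[R]_m) :
  exists! z : 'cV[R]_n, is_min_length_solution B c z.
Proof.
have [w hw] := normal_eq B c; pose z := B^T *m w.
have res z' : sqn (B *m z' - c) = sqn (B *m z - c) + sqn (B *m (z' - z)).
  rewrite -sqnD; first by rewrite mulmxBr [_ - c + _]addrC addrA subrK.
  apply: trmx_inj; rewrite trmx_mul trmxK trmx0 trmx_mul -mulmxA mulmxBr hw.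
  by rewrite subrr mulmx0.
have zP : is_lsq_solution B c z by move=> z'; rewrite norm2_le (res z') lerDl.
have len z' : is_lsq_solution B c z' -> sqn z' = sqn z + sqn (z' - z).
  move=> /(_ z); rewrite norm2_le res gerDl => /sqn_eq0 h.
  rewrite -sqnD; first by rewrite addrC subrK.
  by rewrite trmx_mul trmxK -mulmxA h mulmx0.
exists z; split.
  by split=> // z' /len h; rewrite norm2_le h lerDl.
move=> z' [z'P /(_ z zP)]; rewrite norm2_le len // gerDl => /sqn_eq0/eqP.
by rewrite subr_eq0 => /eqP.
Qed.

End LeastSquares.

(* Main.v *)
(** The min-length solution of min ||Bz - c|| is the only [z] in the range of
    B^T that satisfies the normal equation B^T (Bz - c) = 0.  Orthogonality to a
    range depends only on that range, and B^T Bz = 0 forces Bz = 0.  Hence, when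
    range N = range A^T, the normal equation N^T A^T (ANy - b) = 0 reduces to
    A^T (ANy - b) = 0, and when range M = range A, the equation
    A^T M M^T (Ax - b) = 0 reduces first to M^T (Ax - b) = 0 and then to
    A^T (Ax - b) = 0.  In both cases the preconditioned solution lies in the
    range of A^T, so it is the min-length solution. *)
Require Import Defs.
From mathcomp Require Import all_boot all_order all_algebra.
From mathcomp Require Import classical_sets reals.
From mathcomp Require Import ring lra.
Import Order.TTheory GRing.Theory Num.Theory.
Local Open Scope ring_scope.

Section LeastSquaresTheory.
Context {R : rcfType}.
Implicit Types m n k : nat.

Definition sqnorm {n} (v : 'cV[R]_n) : R := \sum_(i < n) v i 0 ^+ 2.

Lemma sqnormE {n} (v : 'cV[R]_n) : sqnorm v = (v^T *m v) 0 0.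
Proof. by rewrite mxE; apply: eq_bigr => i _; rewrite mxE expr2. Qed.

Lemma sqnorm_ge0 {n} (v : 'cV[R]_n) : 0 <= sqnorm v.
Proof. by apply: sumr_ge0 => i _; apply: sqr_ge0. Qed.

Lemma sqnorm_le0 {n} (v : 'cV[R]_n) : sqnorm v <= 0 -> v = 0.
Proof.
move=> v0; have /eqP : sqnorm v = 0 by apply/eqP; rewrite eq_le v0 sqnorm_ge0.
rewrite psumr_eq0 => [/allP h|i _]; last exact: sqr_ge0.
apply/colP => i; rewrite mxE; apply/eqP.
by rewrite -sqrf_eq0; apply: h; rewrite mem_index_enum.
Qed.

Lemma ler_norm2 {n k} (u : 'cV[R]_n) (v : 'cV[R]_k) :
  (norm2 u <= norm2 v) = (sqnorm u <= sqnorm v).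
Proof. exact/ler_sqrt/sqnorm_ge0. Qed.

Lemma sqnormD {n} (u v : 'cV[R]_n) :
  sqnorm (u + v) = sqnorm u + 2 * (u^T *m v) 0 0 + sqnorm v.
Proof.
have vu : (v^T *m u) 0 0 = (u^T *m v) 0 0.
  by rewrite !mxE; apply: eq_bigr => i _; rewrite !mxE mulrC.
have uvT : (u + v)^T = u^T + v^T by exact: raddfD.
rewrite !sqnormE uvT mulmxDl !mulmxDr.
have addE (X Y : 'M[R]_1) : (X + Y) 0 0 = X 0 0 + Y 0 0 by rewrite mxE.
by rewrite !addE vu; ring.
Qed.

Lemma sqnormD_orth {n} (u v : 'cV[R]_n) :
  u^T *m v = 0 -> sqnorm (u + v) = sqnorm u + sqnorm v.
Proof. by rewrite sqnormD => ->; rewrite mxE mulr0 addr0. Qed.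

Lemma sqnormZ {n} a (v : 'cV[R]_n) : sqnorm (a *: v) = a ^+ 2 * sqnorm v.
Proof. by rewrite /sqnorm mulr_sumr; apply: eq_bigr => i _; rewrite mxE exprMn. Qed.

Lemma mul_trmx_eq0 {m n} (B : 'M[R]_(m, n)) (z : 'cV[R]_n) :
  B^T *m (B *m z) = 0 -> B *m z = 0.
Proof.
move=> h; apply: sqnorm_le0.
by rewrite sqnormE trmx_mul -mulmxA h mulmx0 mxE.
Qed.

(** [B *m (B^T *m r)] lies in the range of [B], so it equals some [C *m w], and the squared norm of
    [B^T *m r] is [r^T C w = 0]. *)
Lemma colrange_orth {m n k} (B : 'M[R]_(m, n)) (C : 'M[R]_(m, k))
    (r : 'cV[R]_m) :
  (colrange B `<=` colrange C)%classic -> C^T *m r = 0 -> B^T *m r = 0.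
Proof.
move=> sBC Cr; apply: sqnorm_le0.
have [w _ Cw] : colrange C (B *m (B^T *m r)) by apply: sBC; exists (B^T *m r).
rewrite sqnormE trmx_mul trmxK -mulmxA -Cw mulmxA -[r^T *m C]trmxK.
by rewrite trmx_mul trmxK Cr trmx0 mul0mx mxE.
Qed.

Lemma lsq_solutionP {m n} (B : 'M[R]_(m, n)) (c : 'cV[R]_m) (z : 'cV[R]_n) :
  is_lsq_solution B c z <-> B^T *m (B *m z - c) = 0.
Proof.
have res z' : B *m z' - c = (B *m z - c) + B *m (z' - z).
  by rewrite mulmxBr [RHS]addrC addrA subrK.
split=> [lsq|orth z']; last first.
  rewrite ler_norm2 (res z') (sqnormD_orth (_ - c)) ?lerDl ?sqnorm_ge0 //.
  by apply: trmx_inj; rewrite trmx_mul trmxK trmx_mul -mulmxA orth mulmx0 trmx0.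
set g := B^T *m _; set K := sqnorm (B *m g).
(* The step minimizing the residual along the gradient is |g|^2 / K; using
   K + 1 instead of K avoids a case split on K = 0. *)
pose t := sqnorm g / (K + 1).
have K0 : 0 <= K by exact: sqnorm_ge0.
have K1 : K + 1 != 0 by rewrite gt_eqF // ltr_wpDl.
have tK : sqnorm g = t * (K + 1) by rewrite /t divfK.
have := lsq (z - t *: g).
rewrite ler_norm2 (res (z - _)) [z - _ - z]addrAC subrr add0r -scaleNr.
rewrite -scalemxAr (sqnormD (_ - c)).
have -> : ((B *m z - c)^T *m (- t *: (B *m g))) 0 0 = - t * sqnorm g.
  rewrite -scalemxAr mxE sqnormE; congr (_ * (_ : 'M_1) 0 0).
  by rewrite mulmxA -[(_ - c)^T *m B]trmxK trmx_mul trmxK.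
rewrite sqnormZ -/K tK sqrrN => le.
(* After cancellation [le] says [0 <= - t^2 (K + 2)], while [K >= 0]. *)
have t0 : t = 0 by nra.
by apply: sqnorm_le0; rewrite tK t0 mul0r.
Qed.

(** Least squares solutions differ by elements of the kernel of [B], which is the orthogonal
    complement of the range of [B^T]. *)
Lemma min_length_solutionP {m n} (B : 'M[R]_(m, n)) (c : 'cV[R]_m)
    (z : 'cV[R]_n) :
  is_min_length_solution B c z <->
  B^T *m (B *m z - c) = 0 /\ colrange B^T z.
Proof.
split=> [[/lsq_solutionP lsq minz]|[orth [w _ zE]]].
  split=> //.
  (* B^T w is the orthogonal projection of z onto the range of B^T. *)
  have [w [[/lsq_solutionP]]] := min_length_solution_exists_unique B^T z.
  rewrite trmxK mulmxBr => /eqP; rewrite subr_eq0 => /eqP proj _ _.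
  exists w => //; apply/eqP; rewrite eq_sym -subr_eq0; apply/eqP/sqnorm_le0.
  (* By [proj] the projection has the same residual as [z], so it competes with [z]; by Pythagoras
     it is strictly shorter unless equal. *)
  have : norm2 z <= norm2 (B^T *m w).
    by apply/minz/lsq_solutionP; rewrite proj.
  rewrite ler_norm2 -[X in sqnorm X <= _](subrK (B^T *m w)) addrC sqnormD_orth.
    by rewrite gerDl.
  by rewrite trmx_mul trmxK -mulmxA mulmxBr proj subrr mulmx0.
split=> [|z' /lsq_solutionP orth']; first exact/lsq_solutionP.
have d0 : B *m (z' - z) = 0.
  apply: mul_trmx_eq0; have -> : B *m (z' - z) = (B *m z' - c) - (B *m z - c).
    by rewrite mulmxBr opprB addrA subrK.
  by rewrite mulmxBr orth orth' subrr.
rewrite ler_norm2 -[z'](subrK z) addrC sqnormD_orth ?lerDl ?sqnorm_ge0 //.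
by rewrite -zE trmx_mul trmxK -mulmxA zE d0 mulmx0.
Qed.

Lemma min_length_solution_unique {m n} (B : 'M[R]_(m, n)) (c : 'cV[R]_m)
    (z z' : 'cV[R]_n) :
  is_min_length_solution B c z -> is_min_length_solution B c z' -> z = z'.
Proof.
have [z0 [_ uniq0]] := min_length_solution_exists_unique B c.
by move=> /uniq0 <- /uniq0.
Qed.

End LeastSquaresTheory.

Theorem theorem3p2 (R : realType) (m n p q : nat)
    (A : 'M[R]_(m, n)) (b : 'cV[R]_m) (N : 'M[R]_(n, p)) (M : 'M[R]_(m, q))
    (x : 'cV[R]_n) (y : 'cV[R]_p) (xright xleft : 'cV[R]_n)
    (hx : is_min_length_solution A b x)
    (hy : is_min_length_solution (A *m N) b y)
    (hright : xright = N *m y)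
    (hleft : is_min_length_solution (M^T *m A) (M^T *m b) xleft) :
  (colrange N = colrange A^T -> xright = x) /\
  (colrange M = colrange A -> xleft = x).
Proof.
split=> [rangeN|rangeM].
  apply: (min_length_solution_unique A b) => //.
  move/min_length_solutionP: hy => [orth _].
  apply/min_length_solutionP; split; last by rewrite -rangeN hright; exists y.
  (* With [r] the residual, [A^T r] is orthogonal to the range of [N], yet lies in that range. *)
  apply: mul_trmx_eq0; apply: (colrange_orth _ N); first by rewrite rangeN.
  by rewrite mulmxA -trmx_mul hright mulmxA.
apply: (min_length_solution_unique A b) => //.
move/min_length_solutionP: hleft => [orth [w _ xE]].
apply/min_length_solutionP; split.
  apply: (colrange_orth _ M); first by rewrite rangeM.
  (* Being of the form [A *m v], this vector vanishes once [A^T] kills it, which is what [orth]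
     says. *)
  have [v _ vE] : colrange A (M *m (M^T *m (A *m xleft - b))).
    by rewrite -rangeM; exists (M^T *m (A *m xleft - b)).
  have Mr : M *m (M^T *m (A *m xleft - b)) = 0.
    rewrite -vE; apply: mul_trmx_eq0; rewrite vE.
    by move: orth; rewrite trmx_mul trmxK -!mulmxA -mulmxBr.
  by apply: mul_trmx_eq0; rewrite trmxK Mr.
by exists (M *m w) => //; rewrite -xE trmx_mul trmxK mulmxA.
Qed.
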